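(* \[ H_{\mathrm{even}}\cap[2,1200]=\{2,6,10,18,26,30,46,62,82,122\}. \]
   Context: 3-Higgs primes are defined recursively: $2$ is 3-Higgs; an odd prime $p$ is 3-Higgs if and only if every prime factor $q$ of $p-1$ is a 3-Higgs prime (necessarily $q<p$) and satisfies $v_q(p-1)\le 3$ (including $v_2(p-1)\le 3$), where $v_q$ is the $q$-adic valuation. $H$ is the set of integers $m\ge 1$ such that every prime factor of $2^m+1$ is 3-Higgs, and $H_{\mathrm{even}}=H\cap 2\mathbb{Z}$. *)

(* Defs.v *)
From mathcomp Require Import all_boot classical_sets.

Set Implicit Arguments.
Unset Strict Implicit.
Unset Printing Implicit Defensive.

Local Open Scope classical_set_scope.

(* Every prime factor of p.-1 is smaller than p, so the recursive definition
   has a unique solution and coincides with this least one. *)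
Inductive higgs3 : nat -> Prop :=
| higgs3_two : higgs3 2
| higgs3_odd p :
    prime p -> odd p ->
    (forall q, prime q -> q %| p.-1 -> higgs3 q) ->
    (forall q, prime q -> q %| p.-1 -> logn q p.-1 <= 3) ->
    higgs3 p.

Definition H : set nat :=
  [set m | 1 <= m /\ forall p, prime p -> p %| 2 ^ m + 1 -> higgs3 p].

Definition H_even : set nat := H `&` [set m | 2 %| m].

(* Main.v *)
Require Import Defs.
From Stdlib Require Import BinNat.
From mathcomp Require Import all_boot cyclic classical_sets.
From mathcomp Require Import zify.

(** If [d] divides [m] with an odd quotient, then [2 ^ d + 1] divides
    [2 ^ m + 1].  So one prime factor of [2 ^ d + 1] that is not 3-Higgs excludes
    every odd multiple of [d].  The even [m <= 1200] outside the set are odd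
    multiples of 4 (excluded by 17) or of one of 119 numbers [d = 2 * k] with [k]
    odd, or they are multiples of 8; these are excluded together, because every
    prime factor of [2 ^ m + 1] is then 1 modulo 16.

    The divisors of [2 ^ d + 1] in question have up to 179 digits, but none of
    them has to be proved prime, nor even to be prime.  Let [D] divide
    [2 ^ d + 1] and suppose that some [b] satisfies [b ^ (q ^ 4) = 1] modulo
    [D], where [q] is prime and [b ^ (q ^ 3) - 1] is prime to [D].  Then [b] has
    order [q ^ 4] modulo every prime factor [p] of [D], so that [q ^ 4] divides
    [p - 1] and [p] is not 3-Higgs ([higgs3_free_fourth_power]).  For example,
    one residue with [b ^ 8 = -1] is enough when [q = 2].  In the same way, if no
    prime factor of [Q] is 3-Higgs, if [b ^ Q = 1] modulo [D], and if [b - 1] is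
    prime to [D], then no prime factor of [D] is 3-Higgs
    ([higgs3_free_order]).  Chains of such pairs [(D, b)] refute each [d].

    For the ten exponents in the set, [2 ^ m + 1] is factored completely.  A
    full factorization of [p - 1] together with a primitive root modulo [p]
    proves at the same time that [p] is prime (Lucas) and, inductively, that it
    is 3-Higgs ([higgs3_of_order]).

    All these data are checked by computation with binary integers. *)

Set Implicit Arguments.
Unset Strict Implicit.
Unset Printing Implicit Defensive.

Local Open Scope classical_set_scope.

(** * Orders of residues modulo a prime *)

Lemma eq_modn_dvd d n a b : d %| n -> a = b %[mod n] -> a = b %[mod d].
Proof. by move=> d_n ab; rewrite -(modn_dvdm a d_n) ab modn_dvdm. Qed.

Lemma expn_gcd_modn p b m n :
  0 < m -> b ^ m = 1 %[mod p] -> b ^ n = 1 %[mod p] ->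
  b ^ gcdn m n = 1 %[mod p].
Proof.
have expX k l : b ^ k = 1 %[mod p] -> b ^ (l * k) = 1 %[mod p].
  by move=> bk; rewrite mulnC expnM -modnXm bk modnXm exp1n.
move=> m_gt0 bm bn; case: (egcdnP n m_gt0) => km kn Bezout _.
by rewrite -(expX _ km bm) Bezout expnD -modnMml expX // modnMml mul1n.
Qed.

Lemma expn_gcd_pred_prime p b n :
  prime p -> 0 < n -> b ^ n = 1 %[mod p] -> b ^ gcdn n p.-1 = 1 %[mod p].
Proof.
move=> p_pr n_gt0 bn; apply: expn_gcd_modn => //.
rewrite -(totient_prime p_pr) Euler_exp_totient // coprime_sym prime_coprime //.
apply/negP=> p_b; have: p %| b ^ n by rewrite Euclid_dvdX ?p_b.
by rewrite /dvdn bn -/(dvdn p 1) Euclid_dvd1.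
Qed.

(** The step behind Pocklington's criterion: [b ^ n = 1] and [b ^ (n / q) <> 1]
    force the order of [b] modulo [p] to contain the full power of [q] in [n],
    and this order divides [p - 1]. *)
Lemma pfactor_dvdn_pred_prime p b n q :
  prime p -> prime q -> 0 < n ->
  b ^ n = 1 %[mod p] -> b ^ (n %/ q) <> 1 %[mod p] ->
  q ^ logn q n %| p.-1.
Proof.
move=> p_pr q_pr n_gt0 bn bnq; have bg := expn_gcd_pred_prime p_pr n_gt0 bn.
have p1_gt0 : 0 < p.-1 by rewrite -subn1 subn_gt0 prime_gt1.
rewrite pfactor_dvdn // leqNgt; apply/negP=> v_lt; apply: bnq.
have g_gt0 : 0 < gcdn n p.-1 by rewrite gcdn_gt0 n_gt0.
have /dvdnP[t def_n] := dvdn_gcdl n p.-1.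
have t_gt0 : 0 < t by move: n_gt0; rewrite def_n muln_gt0 => /andP[].
have q_t : q %| t.
  rewrite -[q]expn1 pfactor_dvdn //.
  have := dvdn_leq_log q p1_gt0 (dvdn_gcdr n p.-1).
  by move: v_lt; rewrite {1}def_n lognM //; lia.
by rewrite def_n [t * _]mulnC -muln_divA // expnM -modnXm bg modnXm exp1n.
Qed.

(** Lucas's primality criterion.  Applied to a prime factor [p] of [n], the
    previous lemma gives that [n - 1] divides [p - 1], hence [p = n]. *)
Lemma prime_of_order n b :
  1 < n -> b ^ n.-1 = 1 %[mod n] ->
  (forall p q, prime p -> p %| n -> prime q -> q %| n.-1 ->
     b ^ (n.-1 %/ q) <> 1 %[mod p]) ->
  prime n.
Proof.
move=> n_gt1 bn ord_b.
have n1_gt0 : 0 < n.-1 by rewrite -subn1 subn_gt0.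
set p := pdiv n; have p_pr : prime p by rewrite pdiv_prime.
have p_n : p %| n := pdiv_dvd n.
suff /dvdn_leq : n.-1 %| p.-1.
  have := dvdn_leq (ltnW n_gt1) p_n; have := prime_gt1 p_pr => *.
  by have <- : p = n by lia.
apply/dvdn_partP=> // q; rewrite mem_primes => /and3P[q_pr _ q_n].
rewrite p_part; apply: pfactor_dvdn_pred_prime (ord_b p q _ _ _ _) => //.
exact: eq_modn_dvd p_n bn.
Qed.

(** * Higgs primes from orders of residues *)

Definition higgs3_free n := forall p, prime p -> p %| n -> ~ higgs3 p.

Lemma higgs3_pred p q : higgs3 p -> prime q -> q %| p.-1 -> higgs3 q.
Proof.
case=> [q_pr|r _ _ hr _ q_pr]; first by rewrite Euclid_dvd1.
exact: hr.
Qed.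

Lemma higgs3_logn p q : higgs3 p -> prime q -> logn q p.-1 <= 3.
Proof.
case=> [_|r _ _ _ hr q_pr]; first by rewrite logn1.
case: (boolP (q %| r.-1)) => [/hr->//|/negPf q_r].
by rewrite lognE q_r !andbF.
Qed.

(** [b] has order exactly [q ^ 4] modulo each prime factor [p] of [n], so the
    valuation of [p - 1] at [q] exceeds 3. *)
Lemma higgs3_free_fourth_power n q b :
  prime q -> b ^ (q ^ 4) = 1 %[mod n] ->
  (forall p, prime p -> p %| n -> b ^ (q ^ 3) <> 1 %[mod p]) ->
  higgs3_free n.
Proof.
move=> q_pr bn ord_b p p_pr p_n p_higgs.
have q_gt0 := prime_gt0 q_pr.
have p1_gt0 : 0 < p.-1 by rewrite -subn1 subn_gt0 prime_gt1.
have : q ^ logn q (q ^ 4) %| p.-1.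
  apply: (@pfactor_dvdn_pred_prime p b) => //.
  - by rewrite expn_gt0 q_gt0.
  - exact: eq_modn_dvd p_n bn.
  - by rewrite expnS mulKn //; apply: ord_b.
by rewrite pfactorK // pfactor_dvdn // ltnNge higgs3_logn.
Qed.

(** The order of [b] modulo a prime factor [p] of [n] divides [Q] and is not 1, so
    [p - 1] shares a prime factor with [Q].  Neither [n] nor [Q] has to be
    prime. *)
Lemma higgs3_free_order n Q b :
  0 < Q -> higgs3_free Q -> b ^ Q = 1 %[mod n] ->
  (forall p, prime p -> p %| n -> b <> 1 %[mod p]) ->
  higgs3_free n.
Proof.
move=> Q_gt0 Q_free bn b_neq1 p p_pr p_n p_higgs.
apply: (b_neq1 p p_pr p_n); set g := gcdn Q p.-1.
have bg : b ^ g = 1 %[mod p].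
  exact: expn_gcd_pred_prime (eq_modn_dvd p_n bn).
suff g1 : g = 1 by move: bg; rewrite g1 expn1.
apply/eqP; apply: contraT => g_neq1.
have g_gt1 : 1 < g by rewrite ltn_neqAle eq_sym g_neq1 gcdn_gt0 Q_gt0.
have r_g := pdiv_dvd g; have r_pr := pdiv_prime g_gt1.
case: (Q_free _ r_pr (dvdn_trans r_g (dvdn_gcdl _ _))).
exact: higgs3_pred p_higgs r_pr (dvdn_trans r_g (dvdn_gcdr _ _)).
Qed.

Lemma prime_higgs3 p : higgs3 p -> prime p.
Proof. by case. Qed.

(** The hypotheses on [b] make [n] prime by Lucas's criterion, and the same
    factorization of [n - 1] is what the definition of 3-Higgs asks for. *)
Lemma higgs3_of_order n b s :
  1 < n -> odd n -> (forall q, q \in s -> higgs3 q) ->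
  \prod_(q <- s) q = n.-1 ->
  all (fun q => ~~ (q ^ 4 %| n.-1)) s ->
  b ^ n.-1 = 1 %[mod n] ->
  (forall q, q \in s -> forall p, prime p -> p %| n ->
    b ^ (n.-1 %/ q) <> 1 %[mod p]) ->
  higgs3 n.
Proof.
move=> n_gt1 n_odd s_higgs def_n s_exp bn ord_b.
have n1_gt0 : 0 < n.-1 by rewrite -subn1 subn_gt0.
have in_s q : prime q -> q %| n.-1 -> q \in s.
  move=> q_pr; rewrite -def_n Euclid_dvd_prod // big_has => /hasP[r r_s].
  by rewrite dvdn_prime2 // => [/eqP->//|]; exact: prime_higgs3 (s_higgs r r_s).
apply: higgs3_odd => //.
- apply: (@prime_of_order _ b) => // p q p_pr p_n q_pr /(in_s q q_pr) q_s.
  exact: ord_b.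
- by move=> q q_pr /(in_s q q_pr) /s_higgs.
- move=> q q_pr /(in_s q q_pr) /(allP s_exp).
  by rewrite pfactor_dvdn // -ltnNge.
Qed.

(** The hypothesis says that [m] is an odd multiple of [d]: then
    [2 ^ m = (2 ^ d) ^ odd = -1] modulo [2 ^ d + 1]. *)
Lemma dvdn_2exp_add1 d m : m %% (2 * d) = d -> 2 ^ d + 1 %| 2 ^ m + 1.
Proof.
move=> m_d; set a := 2 ^ d; have a_gt0 : 0 < a by rewrite expn_gt0.
have sq_a : a ^ 2 = 1 %[mod a + 1].
  apply/eqP; rewrite eqn_mod_dvd ?expn_gt0 ?a_gt0 //.
  by rewrite -[1 in X in _ %| X](exp1n 2) subn_sqr dvdn_mull.
have pow_a i : 2 ^ (i * (2 * d)) = 1 %[mod a + 1].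
  by rewrite mulnC [2 * d]mulnC !expnM -modnXm sq_a modnXm exp1n.
apply/eqP; rewrite (divn_eq m (2 * d)) m_d expnD -/a.
by rewrite -modnDml -modnMml pow_a modnMml mul1n modnDml modnn.
Qed.

(** [2 ^ (m / 8)] has order 16 modulo every prime factor of [2 ^ m + 1], as its
    eighth power is -1. *)
Lemma higgs3_free_2exp_add1 m : 8 %| m -> 0 < m -> higgs3_free (2 ^ m + 1).
Proof.
move=> m8 m_gt0.
apply: (@higgs3_free_fourth_power _ 2 (2 ^ (m %/ 8))) => //.
  rewrite -expnM -[2 ^ 4]/(8 * 2) mulnA divnK // expnM.
  apply/eqP; rewrite eqn_mod_dvd ?expn_gt0 //.
  by rewrite -[1 in X in _ %| X](exp1n 2) subn_sqr dvdn_mull.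
move=> p p_pr p_n; rewrite -expnM divnK // => /eqP.
rewrite eqn_mod_dvd ?expn_gt0 // => p_n'.
have: p %| (2 ^ m + 1) - (2 ^ m - 1) by apply: dvdn_sub.
have -> : 2 ^ m + 1 - (2 ^ m - 1) = 2 by have := expn_gt0 2 m; lia.
rewrite dvdn_prime2 // => /eqP p2.
by move: p_n; rewrite p2 dvdn2 oddD oddX /= orbF eqn0Ngt m_gt0.
Qed.

(** * Modular arithmetic on binary integers *)

Lemma nat_of_bin_add (a b : N) : (a + b)%num = a + b :> nat.
Proof. lia. Qed.

Lemma nat_of_bin_mul (a b : N) : (a * b)%num = a * b :> nat.
Proof. lia. Qed.

Lemma nat_of_binX (a b : N) : (a ^ b)%num = a ^ b :> nat.
Proof.
elim/N.peano_ind: b => [//|b IH].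
rewrite N.pow_succ_r' nat_of_bin_mul IH -expnS; congr expn; lia.
Qed.

Lemma nat_of_bin_divmod (a b : N) : b != 0%num ->
  ((a / b)%num = a %/ b :> nat) * ((a mod b)%num = a %% b :> nat).
Proof.
move=> b_neq0; have r_lt := N.mod_lt a b (elimN eqP b_neq0).
have def_a : a = (a / b)%num * b + (a mod b)%num :> nat.
  by rewrite {1}(N.div_mod' a b); lia.
have r_lt' : (a mod b)%num < (b : nat) by lia.
have b_gt0 : 0 < b by lia.
by split; rewrite [in RHS]def_a ?modnMDl ?modn_small ?divnMDl ?divn_small ?addn0.
Qed.

Lemma nat_of_bin_mod (a b : N) : (a mod b)%num = a %% b :> nat.
Proof.
by have [->|/nat_of_bin_divmod->//] := eqVneq b 0%num; rewrite modn0; case: a.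
Qed.

Lemma coprime_of_bin (a b : N) : N.gcd a b = 1%num -> coprime a b.
Proof.
have coprimeI x y u v : u * x = 1 + v * y -> coprime x y.
  move=> Bezout; rewrite /coprime -dvdn1.
  have : gcdn x y %| 1 + v * y by rewrite -Bezout dvdn_mull ?dvdn_gcdl.
  by rewrite dvdn_addl // dvdn_mull ?dvdn_gcdr.
move=> ab1; have [] := N.gcd_bezout a b; rewrite ab1 => -[u [v Bezout]].
  by apply: (coprimeI _ _ u v); lia.
by rewrite coprime_sym; apply: (coprimeI _ _ u v); lia.
Qed.

Fixpoint expmod_pos (n b : N) (e : positive) : N :=
  match e with
  | xH => b mod n
  | xO e => let r := expmod_pos n b e in (r * r) mod n
  | xI e => let r := expmod_pos n b e in (b * ((r * r) mod n)) mod n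
  end%num.

Definition expmod (n b e : N) : N :=
  if e is Npos e then expmod_pos n b e else (1 mod n)%num.

Lemma expmodE (n b e : N) : expmod n b e = b ^ e %% n :> nat.
Proof.
case: e => [|e] /=; first by rewrite nat_of_bin_mod.
have sqr_mod x : (x %% n) * (x %% n) = x * x %[mod n].
  by rewrite modnMml modnMmr.
elim: e => /= [e IH|e IH|]; rewrite !(nat_of_bin_mod, nat_of_bin_mul) ?expn1 //.
  by rewrite IH sqr_mod modnMmr NatTrec.doubleE expnS -addnn expnD.
by rewrite IH sqr_mod NatTrec.doubleE -addnn expnD.
Qed.

Lemma expmod_eq1 (n b e : N) : expmod n b e == 1%num -> b ^ e = 1 %[mod n].
Proof. by move/eqP/(congr1 nat_of_bin); rewrite expmodE -{2}modn_mod => ->. Qed.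

(** Tests that [b ^ e - 1] is a unit modulo [n], that is, that [b ^ e] differs
    from 1 modulo every prime factor of [n] simultaneously. *)
Definition expmod_sub1_unit (n b e : N) := N.gcd (N.pred (expmod n b e)) n == 1%num.

Lemma expmod_sub1_unitP (n b e : N) p : expmod_sub1_unit n b e -> prime p -> p %| n ->
  b ^ e <> 1 %[mod p].
Proof.
move=> /eqP/coprime_of_bin n_e p_pr p_n be.
have c_mod : expmod n b e = 1 %[mod p] by rewrite expmodE modn_dvdm.
have c_gt0 : 0 < expmod n b e.
  rewrite lt0n; apply/eqP=> c0; move/eqP: c_mod.
  by rewrite c0 eq_sym eqn_mod_dvd // Euclid_dvd1.
have : p %| 1.
  rewrite -(eqP n_e) dvdn_gcd p_n andbT.
  have -> : N.pred (expmod n b e) = expmod n b e - 1 :> nat by lia.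
  by rewrite -eqn_mod_dvd //; apply/eqP.
by rewrite Euclid_dvd1.
Qed.

(** * Certificates *)

(** Iterates [higgs3_free_order]: each modulus of the list takes the role of [Q]
    for the next one. *)
Fixpoint free_chain (Q : N) (s : seq (N * N)) : bool :=
  if s is (n, b) :: s' then
    [&& n != 0%num, expmod n b Q == 1%num, expmod_sub1_unit n b 1 &
        free_chain n s']
  else true.

Lemma free_chainP (Q : N) s : Q != 0%num -> higgs3_free Q -> free_chain Q s ->
  higgs3_free (last Q (unzip1 s)).
Proof.
elim: s Q => [//|[n b] s IH] Q /= Q_neq0 Q_free /and4P[n_neq0 bQ b_sep].
apply: IH => //; apply: (@higgs3_free_order _ Q b) => //; first lia.
  exact: expmod_eq1.
by move=> p p_pr p_n; rewrite -[b : nat]expn1; apply: expmod_sub1_unitP b_sep p_pr p_n.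
Qed.

(** In [(d, q, (n, b), s)], the residue [b] has order [q ^ 4] modulo [n], and [s]
    is a chain that leads from [n] to a divisor of [2 ^ d + 1]. *)
Definition refutation := ((N * N) * (N * N) * seq (N * N))%type.

Definition refuted_exponent (c : refutation) : N := c.1.1.1.

Definition refutation_ok (c : refutation) : bool :=
  let: ((d, q), (n, b), s) := c in
  let D := last n (unzip1 s) in
  [&& prime q, n != 0%num, expmod n b (q ^ 4) == 1%num,
      expmod_sub1_unit n b (q ^ 3), free_chain n s, D != 1%num &
      N.modulo (expmod D 2 d + 1) D == 0%num].

Lemma refutationP (c : refutation) m :
  refutation_ok c ->
  m %% (2 * refuted_exponent c) = refuted_exponent c -> ~ H m.
Proof.
case: c => [[[d q] [n b]] s]; rewrite /refutation_ok /refuted_exponent.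
set D := last _ _.
case/and5P=> q_pr n_neq0 bq4 bq3 /and3P[s_ok D_neq1 D_d] m_d [_ m_higgs].
have D_free : higgs3_free D.
  apply: free_chainP s_ok => //; apply: (@higgs3_free_fourth_power _ q b) => //.
    by have := expmod_eq1 bq4; rewrite nat_of_binX.
  by move=> p p_pr p_n; have := expmod_sub1_unitP bq3 p_pr p_n; rewrite nat_of_binX.
have D_m : D %| 2 ^ m + 1.
  apply: dvdn_trans (dvdn_2exp_add1 m_d); move/eqP/(congr1 nat_of_bin): D_d.
  rewrite nat_of_bin_mod => D_d; rewrite /dvdn -modnDml -[2 ^ d %% D](expmodE D 2 d).
  apply/eqP; rewrite -[RHS]/(nat_of_bin 0) -D_d; congr (_ %% _).
  by rewrite nat_of_bin_add.
have D_gt1 : 1 < D.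
  rewrite ltn_neqAle eq_sym lt0n.
  apply/andP; split; first by clear -D_neq1; lia.
  by apply/eqP=> D0; move: D_m; rewrite D0 dvd0n addn1.
have D_prime := pdiv_prime D_gt1.
apply: (D_free _ D_prime (pdiv_dvd D)); apply: m_higgs => //.
exact: dvdn_trans (pdiv_dvd D) D_m.
Qed.

(** [(n, b, s)]: the list [s] holds the prime factors of [n - 1] with
    multiplicity, and [b] is a primitive root modulo [n]. *)
Definition higgs3_cert := (N * N * seq N)%type.

Definition higgs3_cert_ok (known : seq N) (c : higgs3_cert) : bool :=
  let: (n, b, s) := c in
  [&& N.ltb 1 n, N.modulo n 2 == 1%num,
      all [in known] s, foldr N.mul 1%num s == N.pred n,
      all (fun q => N.modulo (N.pred n) (q ^ 4) != 0%num) s,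
      expmod n b (N.pred n) == 1%num &
      all (fun q => expmod_sub1_unit n b (N.div (N.pred n) q)) s].

Lemma nat_of_bin_prod (s : seq N) :
  foldr N.mul 1%num s = \prod_(q <- s) (q : nat) :> nat.
Proof. by elim: s => [|q s IH]; rewrite ?big_nil // big_cons /= nat_of_bin_mul IH. Qed.

Lemma nat_of_bin_pred (n : N) : N.pred n = n.-1 :> nat.
Proof. lia. Qed.

Lemma higgs3_certP (known : seq N) (c : higgs3_cert) :
  (forall q : N, q \in known -> higgs3 q) -> higgs3_cert_ok known c ->
  higgs3 c.1.1.
Proof.
case: c => [[n b] s] known_higgs; rewrite /higgs3_cert_ok.
case/and5P=> n_gt1 n_odd s_known /eqP def_n /and3P[s_exp bn s_sep].
have s_higgs (q : N) : q \in s -> higgs3 q by move/(allP s_known)/known_higgs.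
have def_n' : \prod_(q <- map nat_of_bin s) q = n.-1.
  by rewrite big_map -nat_of_bin_prod def_n nat_of_bin_pred.
apply: (@higgs3_of_order n b (map nat_of_bin s)) => //.
- by move/N.ltb_lt: n_gt1; clear; lia.
- move/eqP/(congr1 nat_of_bin): n_odd; rewrite nat_of_bin_mod modn2.
  by case: odd.
- by move=> _ /mapP[q /s_higgs ? ->].
- apply/allP=> _ /mapP[q /(allP s_exp) q4 ->].
  apply: contra q4; rewrite -[q ^ 4]/(q ^ nat_of_bin 4) /dvdn.
  by rewrite -nat_of_binX -nat_of_bin_pred -nat_of_bin_mod; lia.
- by have := expmod_eq1 bn; rewrite nat_of_bin_pred.
move=> _ /mapP[q q_s ->] p p_pr p_n.
have := expmod_sub1_unitP (allP s_sep q q_s) p_pr p_n.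
have q_neq0 : q != 0%num by have := prime_gt0 (prime_higgs3 (s_higgs q q_s)); lia.
by rewrite (nat_of_bin_divmod _ q_neq0) nat_of_bin_pred.
Qed.

(** The list [known] grows with each certificate, so the primes have to be listed
    in an order in which the prime factors of [p - 1] precede [p]. *)
Fixpoint higgs3_certs_ok (known : seq N) (cs : seq higgs3_cert) : bool :=
  if cs is c :: cs' then
    higgs3_cert_ok known c && higgs3_certs_ok (c.1.1 :: known) cs'
  else true.

Lemma higgs3_certsP known cs :
  (forall q : N, q \in known -> higgs3 q) -> higgs3_certs_ok known cs ->
  forall q : N, q \in known ++ [seq c.1.1 | c <- cs] -> higgs3 q.
Proof.
elim: cs known => [|c cs IH] known known_higgs /=; first by rewrite cats0.
case/andP=> c_ok cs_ok q; rewrite mem_cat inE orbCA -mem_cat -in_cons -cat_cons.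
apply: IH cs_ok q => q; rewrite inE => /predU1P[->|]; last exact: known_higgs.
exact: higgs3_certP c_ok.
Qed.

Definition factored (primes : seq N) (f : N * seq N) : bool :=
  all [in primes] f.2 && (foldr N.mul 1 f.2 == 2 ^ f.1 + 1)%num.

Lemma factoredP primes f :
  (forall q : N, q \in primes -> higgs3 q) -> factored primes f ->
  f.1 != 0%num -> H f.1.
Proof.
case: f => [m s] primes_higgs /andP[/= s_primes /eqP def_m] m_neq0.
split=> [|p p_pr]; first lia.
have -> : 2 ^ m + 1 = (2 ^ m + 1)%num.
  by rewrite -[2]/(nat_of_bin 2) -nat_of_binX; lia.
rewrite -def_m nat_of_bin_prod Euclid_dvd_prod // big_has => /hasP[q q_s].
have q_higgs := primes_higgs _ (allP s_primes _ q_s).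
by rewrite dvdn_prime2 // => [/eqP->//|]; exact: prime_higgs3.
Qed.

(** * The numerical data *)

Definition higgs3_certs : seq higgs3_cert := [::
  (3, 2, [:: 2]);
  (5, 2, [:: 2; 2]);
  (7, 3, [:: 2; 3]);
  (11, 2, [:: 2; 5]);
  (13, 2, [:: 2; 2; 3]);
  (19, 2, [:: 2; 3; 3]);
  (23, 5, [:: 2; 11]);
  (29, 2, [:: 2; 2; 7]);
  (31, 3, [:: 2; 3; 5]);
  (37, 2, [:: 2; 2; 3; 3]);
  (41, 6, [:: 2; 2; 2; 5]);
  (43, 3, [:: 2; 3; 7]);
  (47, 5, [:: 2; 23]);
  (53, 2, [:: 2; 2; 13]);
  (61, 2, [:: 2; 2; 3; 5]);
  (71, 7, [:: 2; 5; 7]);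
  (73, 5, [:: 2; 2; 2; 3; 3]);
  (107, 2, [:: 2; 53]);
  (109, 6, [:: 2; 2; 3; 3; 3]);
  (131, 2, [:: 2; 5; 13]);
  (157, 5, [:: 2; 2; 3; 13]);
  (173, 2, [:: 2; 2; 43]);
  (181, 2, [:: 2; 2; 3; 3; 5]);
  (251, 6, [:: 2; 5; 5; 5]);
  (277, 5, [:: 2; 2; 3; 23]);
  (293, 2, [:: 2; 2; 73]);
  (457, 13, [:: 2; 2; 2; 3; 19]);
  (733, 6, [:: 2; 2; 3; 61]);
  (1013, 3, [:: 2; 2; 11; 23]);
  (1049, 3, [:: 2; 2; 2; 131]);
  (1321, 13, [:: 2; 2; 2; 3; 5; 11]);
  (1613, 3, [:: 2; 2; 13; 31]);
  (1657, 11, [:: 2; 2; 2; 3; 3; 23]);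
  (1709, 3, [:: 2; 2; 7; 61]);
  (3461, 2, [:: 2; 2; 5; 173]);
  (3517, 2, [:: 2; 2; 3; 293]);
  (5581, 6, [:: 2; 2; 3; 3; 5; 31]);
  (8681, 15, [:: 2; 2; 2; 5; 7; 31]);
  (10169, 3, [:: 2; 2; 2; 31; 41]);
  (12973, 14, [:: 2; 2; 3; 23; 47]);
  (30269, 3, [:: 2; 2; 7; 23; 47]);
  (38767, 5, [:: 2; 3; 7; 13; 71]);
  (49477, 11, [:: 2; 2; 3; 7; 19; 31]);
  (181549, 6, [:: 2; 2; 3; 3; 3; 41; 41]);
  (384773, 3, [:: 2; 2; 29; 31; 107]);
  (3456749, 3, [:: 2; 2; 31; 61; 457]);
  (12112549, 6, [:: 2; 2; 3; 7; 41; 3517]);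
  (43249589, 3, [:: 2; 2; 31; 41; 47; 181]);
  (368140581013, 6, [:: 2; 2; 3; 61; 12973; 38767]);
  (667055378149, 6, [:: 2; 2; 3; 61; 251; 1049; 3461])
]%num.

Definition factorizations : seq (N * seq N) := [::
  (2, [:: 5]);
  (6, [:: 5; 13]);
  (10, [:: 5; 5; 41]);
  (18, [:: 5; 13; 37; 109]);
  (26, [:: 5; 53; 157; 1613]);
  (30, [:: 5; 5; 13; 41; 61; 1321]);
  (46, [:: 5; 277; 1013; 1657; 30269]);
  (62, [:: 5; 5581; 8681; 49477; 384773]);
  (82, [:: 5; 10169; 181549; 12112549; 43249589]);
  (122, [:: 5; 733; 1709; 3456749; 368140581013; 667055378149])
]%num.

(** The divisors written with powers of 2 are, up to a factor 5, one of the two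
    factors in Aurifeuille's identity
    [4 ^ k + 1 = (2 ^ k - 2 ^ ((k + 1) / 2) + 1) * (2 ^ k + 2 ^ ((k + 1) / 2) + 1)]
    for odd [k].  In the entry 1186 the last residue is 16, which has order
    593 modulo every prime factor of the divisor, and 593 is not 3-Higgs. *)
Definition refutations : seq refutation := [::
  (4, 2, (17, 3), [::]);
  (14, 2, (113, 35), [::]);
  (22, 2, (2113, 348), [::]);
  (34, 2, (17, 3), [:: (137, 16)]);
  (38, 2, (525313, 35374), [::]);
  (50, 3, (8101, 211), [::]);
  (54, 2, (246241, 146035), [::]);
  (58, 2, (113, 35), [:: (107367629, 85379517)]);
  (74, 2, (593, 82), [::]);
  (78, 2, (1249, 98), [::]);
  (86, 2, (500177, 489046), [::]);
  (90, 2, (54001, 7177), [::]);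
  (94, 2, (3761, 693), [::]);
  (106, 2, (15358129, 3978044), [::]);
  (118, 2, (157649, 23751), [::]);
    (130, 2, (113, 35), [:: (227, 3); (23609, 50); (108140989558681,
   27458299228747)]);
  (134, 2, (83761, 1315), [:: (2559066073, 55629903)]);
  (138, 2, (17, 3), [:: (5415624023749, 650994585690)]);
  (142, 2, (17, 3), [:: (953, 16); (148587949, 7849381)]);
  (146, 2, (17, 3), [:: (9929, 1070)]);
  (158, 2, (381364611866507317969, 119534950515701766632), [::]);
  (166, 2, (13063537, 1575813), [::]);
  (178, 3, (579017791994999956106149, 266497870672552330091435), [::]);
  (186, 2, (951088215727633, 949439706891531), [::]);
  (194, 2, (97, 8), [:: (389, 5)]);
  (202, 2, (53425037363873248657, 16727291023765976010), [::]);
  (206, 2, (41201, 914), [::]);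
    (214, 2, (353, 36), [:: (37866809061660057264219253397,
   32216192319594617201964152412)]);
    (218, 2, (17, 3), [:: (32575469, 14852223); (82324334351173,
   76335461043085); (3457622042749267, 4398046511104); (171857646012809566969,
   36610742717065056969)]);
  (226, 2, (113, 35), [:: (58309, 16)]);
    (230, 2, (17, 3), [:: (104344301, 3837328); (208688603, 4);
   (359006912765190408181, 349336827282351332544)]);
  (246, 2, (17, 3), [:: (802333429, 72370528)]);
  (254, 2, (26417, 4278), [::]);
  (262, 2, (269665073, 26353727), [::]);
  (274, 2, (17, 3), [:: (137, 16); (189061, 188037)]);
  (278, 2, (17, 3), [:: (1408349, 637856)]);
    (298, 2, (51473, 5908), [:: (11011808951971745915313242336927641,
   340751357485486482655408678914007)]);
    (302, 2, (2 ^ 151 - 2 ^ 76 + 1,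
   311037210139300064375623272122487878308502743), [::]);
  (310, 2, (37201, 7277), [::]);
    (314, 2, (2 ^ 157 + 2 ^ 79 + 1,
   87860831587352579463854675206859993444899371572), [::]);
  (326, 3, (163, 4), [:: (653, 6)]);
  (334, 2, (75005713, 66035999), [::]);
  (338, 3, (180201997, 103969405), [::]);
  (346, 2, (17, 3), [:: (13625405957, 9927647007)]);
    (358, 2, (17, 3), [:: (409, 5); (17320606031, 9739930737);
   (588850381287433028279084110474400181861465037,
   469989101156390108359515183620187637523433683)]);
  (362, 2, (1470213697, 328001851), [:: (28739737348957, 11763001036947)]);
  (366, 2, (5080081, 786427), [::]);
  (382, 2, (25212001, 6648813), [::]);
  (386, 2, (193, 3), [:: (773, 15)]);
    (394, 3, (1459, 34),
   [:: (3862163385805798697201354795194661512726441364448411929,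
   135362901673412920767868218737691848014198441129450665)]);
    (398, 2, (15073, 19), [:: (60293, 16);
   (1008116715344410461444141839610180239223178503751442552629,
   772355869812229807214908266643445339634936040659988467006)]);
    (410, 2, (17, 3), [:: (3061, 25); (18367, 64);
   (76401557052661070266405340180269721, 23225532238485384910514926381358197)]);
    (422, 2, (17, 3), [:: (137, 16);
   (6920400848110359047653995057624941367485834954585997077,
   4490332679495370291888550840220931071742950648848514055)]);
  (446, 2, (95768689, 79221725), [::]);
  (454, 2, (113, 35), [:: (227, 3); (5449, 16)]);
  (458, 2, (33521, 1953), [:: (6211454306149, 800546624402)]);
    (466, 2, (888192486543339587170250231534633545752101759653207234833104273,
   157501987995587772501260593210409807596029328897972433776067380), [::]);
  (478, 2, (17, 3), [:: (239, 6); (77852679293, 39138108303)]);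
  (482, 2, (241, 44), [:: (2640397, 447819)]);
  (502, 2, (17, 3), [:: (371179, 327799); (57762875981, 42251149958)]);
  (514, 2, (257, 2), [:: (28564009, 5799681)]);
  (526, 2, (17, 3), [:: (99972364781, 94246847749)]);
  (538, 2, (8609, 579), [::]);
    (542, 2, (97312479361, 53260817089),
   [:: (62728037516756258715574777675141252652561861165291767427250856249,
   57817983985430768131881037306694400633225130264105259364693111788);
   (7778262174697629363453785911921127017017123583828869656300351035087381155797,
   7014562743918656227140285239588883369169108307979030858794090830762951845107)]);
  (554, 2, (365883785511434081, 134664784038476183), [::]);
  (562, 2, (113, 35), [:: (227, 3); (3827221, 2134860)]);
    (566, 2, (113, 35), [:: ((2 ^ 283 - 2 ^ 142 + 1) / 5,
   145484564432007454987783688935703054980447364815071248451303371978552478950011888102)]);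
  (586, 2, (10561121, 10085355), [:: (12377633813, 6085776324)]);
  (598, 2, (17, 3), [:: (20333, 290)]);
  (610, 2, (183102481, 123814904), [::]);
  (614, 2, (17, 3), [:: (307, 9); (1229, 16)]);
  (622, 2, (17, 3), [:: (21149, 948)]);
  (626, 2, (17, 3), [:: (42569, 272)]);
  (634, 2, (344759057, 201282259), [::]);
    (662, 2,
   (1484943149750594078473339925841207618951167421144378836638232405672667978963835563038783794577,
   290499933997074349628004835959833921519506004025160991188451406931306541358148506369565418493),
   [::]);
  (674, 2, (5393, 14), [::]);
  (694, 2, (17, 3), [:: (103, 8); (5575597, 5048428)]);
  (698, 2, (157661163902833, 32556529786460), [::]);
  (706, 2, (353, 36), [:: (541028249071570661, 540252914756663629)]);
  (718, 2, (585889, 410164), [::]);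
    (734, 2, (2 ^ 367 - 2 ^ 184 + 1,
   137597733752229466352996880915429312682648547334366537031398636684121413077610891147063587856046621573866841264),
   [::]);
  (746, 2, (17, 3), [:: (137, 16); (6996402304983061, 674083030900962)]);
    (758, 2, (2 ^ 379 + 2 ^ 190 + 1,
   599681771573167647448586522268200056964456716511673252810956613088001196802154418037776506637633222599471423387830),
   [::]);
  (766, 2, (17, 3), [:: (111650629, 7041667)]);
  (778, 2, (97, 8), [:: (389, 5); (17117, 16)]);
  (794, 2, (25409, 1486), [::]);
  (802, 2, (401, 30), [:: (3209, 19)]);
  (806, 2, (25793, 4246), [::]);
  (818, 2, (17, 3), [:: (409, 5); (1637, 10)]);
  (838, 2, (53633, 1455), [::]);
  (842, 2, (17, 3), [:: (76943, 1938); (153887, 4); (5442059869, 5290752298)]);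
  (862, 2, (12895071553121, 3051325314327), [::]);
  (866, 2, (433, 151), [:: (1733, 6)]);
  (878, 2, (695377, 650513), [::]);
  (886, 2, (17, 3), [:: (443, 13); (773339215189, 772265473365)]);
  (898, 2, (449, 35), [:: (3593, 28)]);
    (914, 2, (2 ^ 457 - 2 ^ 229 + 1,
   96617196627031412747228301334755678021313280062477415709211720934763910744326156260806663048034456495291078733012325306154000594587838847),
   [::]);
  (922, 2, (14753, 2763), [::]);
  (926, 2, (17, 3), [:: (239, 6); (46475941, 11918137)]);
    (934, 2, (17, 3),
   [:: (1100603995883119094073825425750530966552950894608152596430980623826920507270395336901295098184343128232264188411940641781144774633,
   1005586850567260456531735167905313942486107916573761217527926934609036493066992082699902819832480839225989729614305310461350303086)]);
  (958, 2, (17, 3), [:: (239, 6); (479, 2); (6380281, 2190005)]);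
  (974, 3, (487, 8), [:: (1949, 5)]);
  (982, 2, (1748832017, 367090662), [::]);
  (998, 3, (110758371371929, 89219608305597), [::]);
  (1006, 2, (2264737, 2222529), [:: (350862114989, 245577941234)]);
  (1018, 2, (17, 3), [:: (103837, 58624)]);
  (1042, 2, (16673, 310), [::]);
  (1046, 2, (8369, 253), [::]);
  (1058, 2, (425654561, 134885858), [::]);
  (1066, 2, (2593, 25), [:: (149263453, 36184582)]);
  (1082, 2, (1281089, 653497), [::]);
  (1094, 2, (4337, 1432), [:: (540893293, 302382555)]);
    (1114, 2, (1121297, 69841), [:: ((2 ^ 557 - 2 ^ 279 + 1) / 5,
   76464306060765541304576197666619956213294794046639592545972806338655604570663704759002807859531470012488803120602090002861944461202139773832842393934194362438033639762)]);
  (1126, 2, (133489553, 88499151), [::]);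
  (1138, 2, (113, 35), [:: (257189, 44405)]);
  (1142, 2, (2384497, 1438613), [::]);
  (1154, 2, (577, 27), [:: (2309, 14)]);
  (1174, 2, (2434616217281, 2182437622994), [::]);
  (1186, 2, (593, 82), [:: (2 ^ 593 - 2 ^ 297 + 1, 16)]);
  (1198, 2, (86257, 9928), [::])
]%num.

(** * Even exponents up to 1200 *)

Definition certified_primes : seq N := 2%num :: [seq c.1.1 | c <- higgs3_certs].

Lemma higgs3_certs_valid : higgs3_certs_ok [:: 2%num] higgs3_certs.
Proof. by vm_compute. Qed.

Lemma certified_primes_higgs3 (p : N) : p \in certified_primes -> higgs3 p.
Proof.
apply: higgs3_certsP higgs3_certs_valid p => q.
by rewrite inE => /eqP->; apply: higgs3_two.
Qed.

Lemma factorizations_valid :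
  all (fun f => (f.1 != 0%num) && factored certified_primes f) factorizations.
Proof. by vm_compute. Qed.

Lemma refutations_valid : all refutation_ok refutations.
Proof. by vm_compute. Qed.

Definition good_exponents : seq nat := [seq nat_of_bin f.1 | f <- factorizations].

Lemma good_exponents_H m : m \in good_exponents -> H m.
Proof.
case/mapP=> f /(allP factorizations_valid)/andP[f_neq0 f_ok] ->.
exact: factoredP certified_primes_higgs3 f_ok f_neq0.
Qed.

Definition settled (m : N) : bool :=
  [|| m mod 8 == 0, m \in unzip1 factorizations |
      has (fun c => m mod (2 * refuted_exponent c) == refuted_exponent c)
        refutations]%num.

Lemma even_exponents_settled :
  all (fun j => settled (bin_of_nat j.*2)) (iota 1 600).
Proof. by vm_compute. Qed.

Lemma settled_H m : settled (bin_of_nat m) -> H m -> m \in good_exponents.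
Proof.
move=> m_settled m_H; have m_gt0 : 0 < m by case: m_H.
have m_mod (d r : N) : (bin_of_nat m mod d)%num == r -> m %% d = r.
  by move/eqP <-; rewrite nat_of_bin_mod bin_of_natK.
case/or3P: m_settled => [/m_mod m8 | /mapP[f f_in def_m] | /hasP[c c_in /m_mod m_c]].
- have m_free := higgs3_free_2exp_add1 (introT eqP m8) m_gt0.
  have p_gt1 : 1 < 2 ^ m + 1 by rewrite addn1 ltnS expn_gt0.
  have p_pr := pdiv_prime p_gt1.
  by case: (m_free _ p_pr (pdiv_dvd _)); case: m_H => _; apply=> //; apply: pdiv_dvd.
- by apply/mapP; exists f => //; rewrite -def_m bin_of_natK.
rewrite nat_of_bin_mul in m_c.
by case: (refutationP (allP refutations_valid c c_in) m_c m_H).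
Qed.

Lemma good_exponentsE :
  [set m | m \in good_exponents] = [set 2; 6; 10; 18; 26; 30; 46; 62; 82; 122].
Proof.
apply/seteqP; split=> m /=.
  by rewrite !inE; do 9?[case/orP=> [/eqP->|]]; try move/eqP->;
    repeat first [by right | left].
by do 9?[case=> [|->//]]; move=> ->.
Qed.

Theorem theorem9 :
  H_even `&` [set m | 2 <= m <= 1200] =
  [set 2; 6; 10; 18; 26; 30; 46; 62; 82; 122].
Proof.
rewrite -good_exponentsE; apply/seteqP; split=> m /=.
  case=> -[m_H /= m_even] /andP[m_ge2 m_le1200].
  apply: settled_H => //.
  have m_half : m = m./2.*2 by rewrite even_halfK // -dvdn2.
  rewrite m_half; apply: (allP even_exponents_settled); rewrite mem_iota.
  by apply/andP; split; lia.
move=> m_good; have m_H := good_exponents_H m_good.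
have : all (fun i => (2 %| i) && (2 <= i <= 1200)) good_exponents by vm_compute.
by move/allP/(_ m m_good)/andP=> [].
Qed.
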